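(* Let $(\mathfrak A,[\cdot,\dots,\cdot])$ be an arbitrary $n$-ary algebra. Then for any basis $\mathcal B=\{e_i:i\in I\}$ of $\mathfrak A$ one has the decomposition $$\mathfrak A=\bigoplus_{[\mathfrak A_{[e_i]}]\in\mathcal F/\approx}\overbrace{\mathfrak A_{[e_i]}},$$ where the family $\mathcal F$, the relation $\approx$ and the subspaces $\overbrace{\mathfrak A_{[e_i]}}$ are constructed from $f=[\cdot,\dots,\cdot]$ and $\mathcal B$ as in the context, and every $\overbrace{\mathfrak A_{[e_i]}}$ is an ideal of $\mathfrak A$. Furthermore, any pair of different ideals in this decomposition is $f$-orthogonal.
   Context: An $n$-ary algebra ($n\ge2$) is a linear space $\mathfrak A$ of arbitrary dimension over an arbitrary field $\mathbb F$ with an $n$-linear map $[\cdot,\dots,\cdot]:\mathfrak A\times\cdots\times\mathfrak A\to\mathfrak A$ (the product), no identity being assumed. Write $f$ for the product. A superscript $(k)$ marks the $k$-th entry of $f$: $f(\mathfrak A,\dots,W^{(k)},\dots,\mathfrak A)$ is the span of all values of $f$ with $k$-th entry in $W$ and all other entries in $\mathfrak A$, and $f(\mathfrak A,\dots,V_1^{(k_1)},\dots,V_2^{(k_2)},\dots,\mathfrak A)$ is the span of all values with $k_1$-th entry in $V_1$, $k_2$-th entry in $V_2$ and the other entries in $\mathfrak A$. A linear subspace $\mathfrak I$ is an ideal if $[\mathfrak A,\dots,\mathfrak I^{(r)},\dots,\mathfrak A]\subset\mathfrak I$ for all $r\in\{1,\dots,n\}$. Subspaces $V_1,V_2$ are $f$-orthogonal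 if $f(\mathfrak A,\dots,V_1^{(k_1)},\dots,V_2^{(k_2)},\dots,\mathfrak A)=0$ for all $k_1\ne k_2$ in $\{1,\dots,n\}$. Construction from a basis $\mathcal B$. For each $e\in\mathcal B$ introduce a symbol $\overline e\notin\mathcal B$; $\overline{\mathcal B}=\{\overline e:e\in\mathcal B\}$, $\overline{(\overline e)}:=e$. Let $\mathfrak A^*=\mathfrak A\setminus\{0\}$ and $\mathcal P(\mathfrak A^* )$ its power set. Define $F:\mathcal P(\mathfrak A^* )\times(\mathcal B\dot\cup\overline{\mathcal B})^{n-1}\to\mathcal P(\mathfrak A^* )$ as follows: $F(\emptyset,\dots)=\emptyset$; for $U\ne\emptyset$ and $\xi_1,\dots,\xi_{n-1}\in\mathcal B$, $$F(U,\xi_1,\dots,\xi_{n-1})=\Big(\bigcup_{1\le k\le n,\ \sigma\in\mathbb S_{n-1}}\{f(\xi_{\sigma(1)},\dots,u^{(k)},\dots,\xi_{\sigma(n-1)}):u\in U\}\Big)\setminus\{0\},$$ $$F(U,\overline\xi_1,\dots,\overline\xi_{n-1})=\Big(\bigcup_{1\le k\le n,\ \sigma\in\mathbb S_{n-1}}\{u\in\mathfrak A:f(\xi_{\sigma(1)},\dots,u^{(k)},\dots,\xi_{\sigma(n-1)})\in U\}\Big)\setminus\{0\},$$ where $u$ is in the $k$-th entry and the remaining entries are filled in order by $\xi_{\sigma(1)},\dots,\xi_{\sigma(n-1)}$; and $F(U,\dots)=\emptyset$ if among the last $n-1$ arguments there is one in $\mathcal B$ and one in $\overline{\mathcal B}$.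 $e_i\in\mathcal B$ is connected to $e_j\in\mathcal B$ (written $e_i\sim e_j$) if $e_i=e_j$ or there is an ordered list $(X_1,\dots,X_m)$, $m\ge1$, of $(n-1)$-tuples $X_r\in(\mathcal B\dot\cup\overline{\mathcal B})^{n-1}$ such that $F(\{e_i\},X_1)\ne\emptyset$, $F(F(\{e_i\},X_1),X_2)\neq\emptyset$, ..., $F(\dots F(F(\{e_i\},X_1),X_2)\dots,X_{m-1})\ne\emptyset$ and $e_j\in F(F(\dots F(F(\{e_i\},X_1),X_2)\dots,X_{m-1}),X_m)$. This is an equivalence relation on $\mathcal B$; $[e_i]$ is the class of $e_i$, $\mathfrak A_{[e_i]}:=\bigoplus_{e_j\in[e_i]}\mathbb F e_j$, so $\mathfrak A=\bigoplus_{[e_i]\in\mathcal B/\sim}\mathfrak A_{[e_i]}$, and $\Pi_{\mathfrak A_{[e_i]}}:\mathfrak A\to\mathfrak A_{[e_i]}$ is the associated projection. Let $\mathcal F=\{\mathfrak A_{[e_i]}:[e_i]\in\mathcal B/\sim\}$. Put $\mathfrak A_{[e_i]}\approx\mathfrak A_{[e_j]}$ iff $\mathfrak A_{[e_i]}=\mathfrak A_{[e_j]}$ or there is $\{[\xi_1],\dots,[\xi_m]\}\subset\mathcal B/\sim$ with $[\xi_1]=[e_i]$, $[\xi_m]=[e_j]$ and, for each $r=1,\dots,m-1$, $$\sum_{1\le k_1<k_2\le n}\Big[\Pi_{\mathfrak A_{[\xi_r]}}\big(f(\mathfrak A,\dots,\mathfrak A_{[\xi_{r+1}]}^{(k_1)},\dots,\mathfrak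 A_{[\xi_{r+1}]}^{(k_2)},\dots,\mathfrak A)\big)+\Pi_{\mathfrak A_{[\xi_{r+1}]}}\big(f(\mathfrak A,\dots,\mathfrak A_{[\xi_r]}^{(k_1)},\dots,\mathfrak A_{[\xi_r]}^{(k_2)},\dots,\mathfrak A)\big)\Big]\ne0$$ (a sum of linear subspaces). This is an equivalence relation on $\mathcal F$; $[\mathfrak A_{[e_i]}]$ denotes the class of $\mathfrak A_{[e_i]}$, and $\overbrace{\mathfrak A_{[e_i]}}:=\bigoplus_{\mathfrak A_{[e_j]}\in[\mathfrak A_{[e_i]}]}\mathfrak A_{[e_j]}$. *)

(* Defs.v *)
From mathcomp Require Import all_boot all_order all_algebra all_fingroup.
From mathcomp Require Import boolp classical_sets.

Set Implicit Arguments.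
Unset Strict Implicit.
Unset Printing Implicit Defensive.

Import GRing.Theory.
Local Open Scope ring_scope.
Local Open Scope classical_set_scope.

Section Quotients.
Variable T : Type.
Implicit Types (D : set T) (R : T -> T -> Prop).

Definition class_of D R (x : T) : set T := [set y | D y /\ R x y].

Definition quot D R : set (set T) := class_of D R @` D.

End Quotients.

Section LinearAlgebra.
Variables (K : fieldType) (A : lmodType K).

Definition subspace (W : set A) : Prop := GRing.submod_closed (mem W).

Definition spanS (S : set A) : set A := smallest subspace S.

Definition free_set (B : set A) : Prop :=
  forall (s : seq A) (c : A -> K), uniq s -> (forall v, v \in s -> B v) ->
    \sum_(v <- s) c v *: v = 0 -> forall v, v \in s -> c v = 0.

Definition is_basis (B : set A) : Prop := free_set B /\ spanS B = setT.

Definition sum_sub (J : Type) (D : set J) (V : J -> set A) : set A :=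
  spanS (\bigcup_(j in D) V j).

(* [A] is the internal direct sum of the subspaces [V j], [j] in [D]. *)
Definition direct_sum (J : Type) (D : set J) (V : J -> set A) : Prop :=
  [/\ forall j, D j -> subspace (V j),
      sum_sub D V = setT
    & forall j, D j -> V j `&` sum_sub (D `\ j) V = [set 0]].

(* The projection onto [V i] associated with a decomposition
   [direct_sum D V]: it sends [x] to the (unique) [y] in [V i] such that
   [x - y] lies in the sum of the other summands. *)
Definition proj (J : Type) (D : set J) (V : J -> set A) (i : J) (x : A) : A :=
  xget 0 [set y | V i y /\ sum_sub (D `\ i) V (x - y)].

End LinearAlgebra.

Section NaryAlgebra.
Variables (K : fieldType) (n : nat) (A : lmodType K) (f : ('I_n -> A) -> A).

Definition multilinear : Prop :=
  forall (x : 'I_n -> A) (k : 'I_n), linear (fun u : A => f (dfwith x (i := k) u)).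

Definition prod1 (k : 'I_n) (W : set A) : set A :=
  spanS [set f x | x in [set x | W (x k)]].

Definition prod2 (k1 : 'I_n) (V1 : set A) (k2 : 'I_n) (V2 : set A) : set A :=
  spanS [set f x | x in [set x | V1 (x k1) /\ V2 (x k2)]].

Definition ideal (W : set A) : Prop :=
  subspace W /\ forall r : 'I_n, prod1 r W `<=` W.

Definition f_orthogonal (V1 V2 : set A) : Prop :=
  forall k1 k2 : 'I_n, k1 <> k2 -> prod2 k1 V1 k2 V2 = [set 0].

(* The [n]-tuple with [u] in entry [k], the other entries being filled in order
   by [y]. *)
Definition insert (k : 'I_n) (u : A) (y : 'I_n.-1 -> A) : 'I_n -> A :=
  fun i => oapp y u (unlift k i).

Section Basis.
Variable B : set A.

(* Each [e] in [B] gives two symbols: [inl e] stands for [e] and [inr e] for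
   its formal copy, written with a bar. *)
Definition symbol : Type := (B + B)%type.

Definition Fpos (U : set A) (xi : 'I_n.-1 -> B) : set A :=
  (\bigcup_(k in [set: 'I_n]) \bigcup_(s in [set: 'S_n.-1])
     [set f (insert k u (fun i => val (xi (s i)))) | u in U]) `\ 0.

Definition Fbar (U : set A) (xi : 'I_n.-1 -> B) : set A :=
  (\bigcup_(k in [set: 'I_n]) \bigcup_(s in [set: 'S_n.-1])
     [set u | U (f (insert k u (fun i => val (xi (s i)))))]) `\ 0.

(* If [X] mixes the two kinds of symbols, both alternatives are impossible and
   the value is empty; it is also empty when [U] is. *)
Definition Fmap (U : set A) (X : 'I_n.-1 -> symbol) : set A :=
  [set v | (exists2 xi, X = inl \o xi & Fpos U xi v) \/
           (exists2 xi, X = inr \o xi & Fbar U xi v)].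

Definition connected (e e' : A) : Prop :=
  e = e' \/
  exists Xs : seq ('I_n.-1 -> symbol),
    [/\ (0 < size Xs)%N,
        forall r, (0 < r < size Xs)%N ->
          foldl Fmap [set e] (take r Xs) !=set0
      & foldl Fmap [set e] Xs e'].

Definition basis_classes : set (set A) := quot B connected.

Definition class_sub (c : set A) : set A := spanS c.

Definition Pi (c : set A) : A -> A := proj basis_classes class_sub c.

Definition linked (c d : set A) : Prop :=
  sum_sub [set k : 'I_n * 'I_n | (k.1 < k.2)%N]
    (fun k => spanS
       (Pi c @` prod2 k.1 (class_sub d) k.2 (class_sub d) `|`
        Pi d @` prod2 k.1 (class_sub c) k.2 (class_sub c))) <> [set 0].

Definition class_subs : set (set A) := class_sub @` basis_classes.

Definition approx (V W : set A) : Prop :=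
  V = W \/
  exists (m : nat) (xi : nat -> set A),
    [/\ forall r, (r <= m)%N -> basis_classes (xi r),
        class_sub (xi 0%N) = V,
        class_sub (xi m) = W
      & forall r, (r < m)%N -> linked (xi r) (xi r.+1)].

Definition sub_classes : set (set (set A)) := quot class_subs approx.

Definition merged_sub (C : set (set A)) : set A := sum_sub C id.

End Basis.
End NaryAlgebra.

(* Main.v *)
Require Import Defs.
From mathcomp Require Import all_boot all_order all_algebra all_fingroup.
From mathcomp Require Import boolp classical_sets.

(** Let [b_1, ..., b_n] be basis vectors with [v := f (b_1, ..., b_n)] nonzero.
    Applying [F] to [{b_i}], with the other entries as arguments, reaches [v];
    applying it to [{v}], with the barred symbols of the entries other than
    [b_j], comes back to [b_j].  Hence all the entries of a nonzero product of
    basis vectors are connected to each other ([connected_entries]).  By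
    multilinearity, a product with two entries in the spans of different
    connection classes vanishes; this already yields the orthogonality.

    The product [v] itself may have components outside the span of the class
    [c] of its entries.  But if the component of [v] along a class [d] is not
    zero, then, as [n >= 2] and all entries of [v] lie in [c], it witnesses that
    [c] and [d] are linked.  So every component of [v] lies in the sum of the
    summands equivalent to that of [c] ([product_in_merged_class]), and these
    sums are ideals.

    Every subspace in sight is spanned by a part of the basis, and each merged
    subspace [merged_sub C] is the span of the part [basis_part C].  Distinct
    classes [C] have disjoint parts, since connection and linkage generate
    equivalence relations, and spans of disjoint parts of a basis are
    independent ([span_disjoint]): this gives the direct sum. *)

Set Implicit Arguments.
Unset Strict Implicit.
Unset Printing Implicit Defensive.

Import GRing.Theory.

(** * Spans of parts of a basis *)

Section Spans.
Local Open Scope ring_scope.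
Local Open Scope classical_set_scope.
Variables (K : fieldType) (A : lmodType K).
Implicit Types (B W S T : set A) (s t : seq A) (c : A -> K).

Lemma subspaceP W :
  subspace W <-> W 0 /\ forall a u v, W u -> W v -> W (a *: u + v).
Proof.
split=> [[W0 WD]|[W0 WD]].
  split; first exact: set_mem.
  by move=> a u v /mem_set Wu /mem_set Wv; apply/set_mem; exact: WD.
split; first exact: mem_set.
by move=> a u v /set_mem Wu /set_mem Wv; apply/mem_set; exact: WD.
Qed.

Lemma span_subspace S : subspace (spanS S).
Proof.
apply/subspaceP; split=> [W [sW _]|a u v Su Sv W [sW SW]].
  by case/subspaceP: sW.
case/subspaceP: (sW) => _; apply; first exact: Su.
exact: Sv.
Qed.

Lemma sub_span S : S `<=` spanS S.
Proof. exact: sub_gen_smallest. Qed.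

Lemma span_min S W : subspace W -> S `<=` W -> spanS S `<=` W.
Proof. exact: smallest_sub. Qed.

Lemma span_mono S T : S `<=` T -> spanS S `<=` spanS T.
Proof.
by move=> ST; apply: span_min (span_subspace T) _ => x /ST; exact: sub_span.
Qed.

Lemma subspace0 W : subspace W -> W 0.
Proof. by case/subspaceP. Qed.

Lemma subspaceZ W a u : subspace W -> W u -> W (a *: u).
Proof. by case/subspaceP=> W0 WD Wu; rewrite -[_ *: _]addr0; exact: WD. Qed.

Lemma subspaceD W u v : subspace W -> W u -> W v -> W (u + v).
Proof. by case/subspaceP=> _ WD Wu Wv; rewrite -[u]scale1r; exact: WD. Qed.

Lemma subspaceB W u v : subspace W -> W u -> W v -> W (u - v).
Proof.
by move=> sW Wu Wv; apply: subspaceD => //; rewrite -scaleN1r; exact: subspaceZ.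
Qed.

Lemma subspace_sum W s (P : pred A) (F : A -> A) : subspace W ->
  (forall v, v \in s -> P v -> W (F v)) -> W (\sum_(v <- s | P v) F v).
Proof.
move=> sW WF; rewrite big_seq_cond; elim/big_ind: _ => [|u v|v /andP[]].
- exact: subspace0.
- exact: subspaceD.
- exact: WF.
Qed.

Lemma set1_0_subspace : subspace [set 0 : A].
Proof. by apply/subspaceP; split=> // a u v -> ->; rewrite scaler0 addr0. Qed.

Lemma eq0_set1 W : subspace W -> W `<=` [set 0] -> W = [set 0].
Proof.
by move=> sW W0; apply/seteqP; split=> // _ ->; exact: subspace0.
Qed.

Lemma sum_extend s t c : uniq s -> uniq t -> {subset s <= t} ->
  \sum_(v <- t) (if v \in s then c v else 0) *: v = \sum_(v <- s) c v *: v.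
Proof.
move=> us ut st.
rewrite (eq_bigr (fun v => if v \in s then c v *: v else 0)); last first.
  by move=> v _; case: ifP => _; rewrite ?scale0r.
rewrite -big_mkcond -big_filter; apply: perm_big; apply: uniq_perm => //.
  exact: filter_uniq.
by move=> v; rewrite mem_filter; case: (boolP (v \in s)) => //= /st ->.
Qed.

Lemma spanP S x : spanS S x ->
  exists s c, [/\ uniq s, forall v, v \in s -> S v & x = \sum_(v <- s) c v *: v].
Proof.
pose comb := [set x | exists s c,
  [/\ uniq s, forall v, v \in s -> S v & x = \sum_(v <- s) c v *: v]].
apply: (@span_min S comb); last first.
  move=> v Sv; exists [:: v], (fun=> 1); split=> //.
    by move=> w; rewrite inE => /eqP ->.
  by rewrite big_seq1 scale1r.
apply/subspaceP; split; first by exists [::], (fun=> 0); split; rewrite ?big_nil.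
move=> a _ _ [s [c [us sS ->]]] [t [d [ut tS ->]]].
pose r := undup (s ++ t).
exists r, (fun v => a * (if v \in s then c v else 0) +
                    (if v \in t then d v else 0)); split.
- exact: undup_uniq.
- by move=> v; rewrite mem_undup mem_cat => /orP[/sS|/tS].
rewrite -(@sum_extend s r) ?undup_uniq//; last first.
  by move=> v vs; rewrite mem_undup mem_cat vs.
rewrite -(@sum_extend t r) ?undup_uniq//; last first.
  by move=> v vt; rewrite mem_undup mem_cat vt orbT.
rewrite scaler_sumr -big_split; apply: eq_bigr => v _.
by rewrite scalerDl scalerA.
Qed.

(** The difference of two expressions of [x], over [S] and over [T], is a linear
    relation on [S `|` T].  By disjointness no terms merge, so each coefficient of
    either expression is, up to sign, one of the relation: freeness kills it. *)
Lemma span_disjoint B S T x : free_set B -> S `<=` B -> T `<=` B ->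
  S `&` T `<=` set0 -> spanS S x -> spanS T x -> x = 0.
Proof.
move=> freeB SB TB ST /spanP[s [c [us sS xs]]] /spanP[t [d [ut tT xt]]].
have st v : v \in s -> v \in t -> False.
  by move=> /sS Sv /tT Tv; exact: (ST v).
have ust : uniq (s ++ t).
  rewrite cat_uniq us ut andbT /=; apply/hasPn => v vt.
  by apply/negP => vs; exact: (st v).
have rel : \sum_(v <- s ++ t) (if v \in s then c v else - d v) *: v = 0.
  apply: (@eq_trans _ _ (x - x)); last exact: subrr.
  rewrite big_cat {1}xs xt -sumrN; congr (_ + _); apply: eq_big_seq => v vr.
    by rewrite vr.
  by case: ifP => [vs|_]; [case: (st v)|rewrite scaleNr].
have coef0 := freeB _ _ ust _ rel.
rewrite xs big_seq big1// => v vs.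
have := coef0 _ v; rewrite vs mem_cat vs => -> //; first by rewrite scale0r.
by move=> w; rewrite mem_cat => /orP[/sS/SB|/tT/TB].
Qed.

Lemma free_neq0 B v : free_set B -> B v -> v <> 0.
Proof.
move=> freeB Bv v0; have /eqP := oner_neq0 K; apply.
apply: (freeB [:: v] (fun=> 1)); rewrite ?inE//.
  by move=> w; rewrite inE => /eqP ->.
by rewrite big_seq1 v0 scaler0.
Qed.

Lemma sum_sub_span (J : Type) (D : set J) (S : J -> set A) (V : J -> set A) :
  (forall j, D j -> V j = spanS (S j)) ->
  sum_sub D V = spanS (\bigcup_(j in D) S j).
Proof.
move=> VS; apply/seteqP; split; apply: span_min; try exact: span_subspace.
  move=> x [j Dj]; rewrite VS//; apply: span_mono => y Sy; by exists j.
move=> x [j Dj Sx]; apply: sub_span; exists j => //.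
by rewrite VS//; exact: sub_span.
Qed.

Lemma direct_sum_span B (J : Type) (D : set J) (S : J -> set A)
    (V : J -> set A) : is_basis B -> (forall j, D j -> V j = spanS (S j)) ->
  \bigcup_(j in D) S j = B ->
  (forall i j v, D i -> D j -> S i v -> S j v -> i = j) ->
  direct_sum D V.
Proof.
move=> [freeB spanB] VS SB disj; split.
- by move=> j Dj; rewrite VS//; exact: span_subspace.
- by rewrite (sum_sub_span VS) SB.
move=> j Dj; rewrite (@sum_sub_span _ _ S) ?VS//; last by move=> k [/VS].
apply/seteqP; split=> [x [xj xr]|_ ->]; last first.
  by split; apply: subspace0; exact: span_subspace.
apply: (span_disjoint freeB _ _ _ xj xr).
- by move=> v Sv; rewrite -SB; exists j.
- by move=> v [k [Dk _] Sv]; rewrite -SB; exists k.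
- by move=> v [Sv [k [Dk jk] Skv]]; apply: jk; exact: (disj _ _ v).
Qed.

Lemma proj_eq (J : Type) (D : set J) (V : J -> set A) i x y :
  direct_sum D V -> D i -> V i y -> sum_sub (D `\ i) V (x - y) ->
  proj D V i x = y.
Proof.
move=> [sV _ VI] Di Viy xy; apply: xget_subset1 => // u v [Vu xu] [Vv xv].
apply/eqP; rewrite -subr_eq0; apply/eqP.
have : [set 0] (u - v) => //; rewrite -(VI i Di); split.
  exact: (subspaceB (sV i Di)).
have -> : u - v = (x - v) - (x - u).
  by rewrite opprB [RHS]addrC subrKA.
exact: (subspaceB (span_subspace _)).
Qed.

(** The vectors of a subspace that a linear map sends into another subspace form
    a subspace, so each entry can be extended from a set to its span; the entries
    are treated one after the other. *)
Lemma multilinear_span (n : nat) (f : ('I_n -> A) -> A) (S : 'I_n -> set A) W :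
  multilinear f -> subspace W ->
  (forall x, (forall i, S i (x i)) -> W (f x)) ->
  forall x, (forall i, spanS (S i) (x i)) -> W (f x).
Proof.
move=> hf sW fS.
(* The entries of index below [j] range over the spans, the others over the
   spanning sets. *)
suff step j x : (j <= n)%N ->
    (forall i : 'I_n, (if (i < j)%N then spanS (S i) else S i) (x i)) -> W (f x).
  by move=> x Sx; apply: (step n) => // i; rewrite ltn_ord.
elim: j x => [|j IH] x jn Sx.
  by apply: fS => i; exact: Sx.
pose k := Ordinal jn.
have -> : x = dfwith x (i := k) (x k).
  by apply: funext => i; case: dfwithP.
have := Sx k; rewrite /= ltnSn.
apply: (@span_min _ [set u | W (f (dfwith x (i := k) u))]) => [|u Su].
  apply/subspaceP; split=> [|a u v Wu Wv] /=.
    have := hf x k (-1) 0 0; rewrite scaler0 add0r scaleN1r addNr => ->.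
    exact: subspace0.
  by rewrite (hf x k); case/subspaceP: sW => _; apply.
apply: IH => [|i]; first exact: ltnW.
have [<-|ki] := eqVneq k i; first by rewrite dfwith_in ltnn.
rewrite dfwith_out//; have := Sx i; rewrite ltnS leq_eqVlt.
by rewrite [i == j :> nat]eq_sym (inj_eq val_inj k i) (negbTE ki).
Qed.

End Spans.

(** * Connection classes *)

Section Connection.
Local Open Scope ring_scope.
Local Open Scope classical_set_scope.
Variables (K : fieldType) (n : nat) (A : lmodType K) (f : ('I_n -> A) -> A).
Variable B : set A.
Local Notation F := (Fmap f (B := B)).

(** Connection between arbitrary vectors, since the intermediate sets of a
    chain need not meet the basis. *)
Definition reaches (u v : A) : Prop :=
  exists Xs : seq ('I_n.-1 -> symbol B), foldl F [set u] Xs v.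

Lemma Fmap_bigcup (U : set A) (X : 'I_n.-1 -> symbol B) v :
  F U X v <-> exists2 u, U u & F [set u] X v.
Proof.
split=> [[[xi Xxi]|[xi Xxi]] [[k _ [s _]]]|[u Uu [[xi Xxi]|[xi Xxi]] [[k _ [s _]]]]].
- move=> [u Uu uv] v0; exists u => //; left; exists xi => //.
  by split=> //; exists k => //; exists s => //; exists u.
- move=> Uf v0; exists (f (insert k v (fun i => val (xi (s i))))) => //.
  by right; exists xi => //; split=> //; exists k => //; exists s.
- move=> [_ -> uv] v0; left; exists xi => //.
  by split=> //; exists k => //; exists s => //; exists u.
- move=> /= fu v0; right; exists xi => //.
  by split=> //; exists k => //; exists s => //=; rewrite fu.
Qed.

Lemma foldl_Fmap_bigcup (U : set A) (Xs : seq ('I_n.-1 -> symbol B)) v :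
  foldl F U Xs v <-> exists2 u, U u & foldl F [set u] Xs v.
Proof.
elim: Xs U => [|X Xs IH] U /=; first by split=> [|[u Uu ->]//]; exists v.
rewrite IH; split=> [[w /Fmap_bigcup[u Uu uw] wv]|[u Uu]].
  by exists u => //; apply/IH; exists w.
rewrite IH => -[w uw wv]; exists w => //.
by apply/Fmap_bigcup; exists u.
Qed.

(** The nonemptiness conditions on the intermediate sets hold as soon as the last
    set is nonempty, because [F] maps the empty set to itself. *)
Lemma connectedE e e' : connected f B e e' <-> reaches e e'.
Proof.
split=> [[->|[Xs [_ _ ee']]]|[Xs ee']]; [by exists [::]|by exists Xs|].
have [sXs|] := ltnP 0 (size Xs); last first.
  by rewrite leqn0 => /nilP Xs0; left; move: ee'; rewrite Xs0 /= => ->.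
right; exists Xs; split=> // r _; move: ee'.
rewrite -{1}(cat_take_drop r Xs) foldl_cat => /foldl_Fmap_bigcup[u eu _].
by exists u.
Qed.

Lemma reaches_refl u : reaches u u.
Proof. by exists [::]. Qed.

Lemma reaches_trans u v w : reaches u v -> reaches v w -> reaches u w.
Proof.
move=> [Xs uv] [Ys vw]; exists (Xs ++ Ys); rewrite foldl_cat.
by apply/foldl_Fmap_bigcup; exists v.
Qed.

(** Barred and unbarred symbols act by converse relations on nonzero vectors. *)
Lemma Fmap_converse u v (X : 'I_n.-1 -> symbol B) : u <> 0 ->
  F [set u] X v -> v <> 0 /\ exists Y, F [set v] Y u.
Proof.
move=> u0 [[xi Xxi]|[xi Xxi]] [[k _ [s _]]].
- move=> [_ -> uv] v0; split=> //; exists (inr \o xi); right; exists xi => //.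
  by split=> //; exists k => //; exists s.
- move=> /= fv v0; split=> //; exists (inl \o xi); left; exists xi => //.
  by split=> //; exists k => //; exists s => //; exists v.
Qed.

Lemma reaches_sym u v : u <> 0 -> reaches u v -> reaches v u.
Proof.
move=> u0 [Xs]; elim: Xs u u0 => [|X Xs IH] u u0 /=.
  by move=> ->; exact: reaches_refl.
move=> /foldl_Fmap_bigcup[w /(Fmap_converse u0)[w0 [Y wu]] wv].
by apply: reaches_trans (IH w w0 wv) _; exists [:: Y].
Qed.

Lemma insert_lift (x : 'I_n -> A) k : insert k (x k) (fun i => x (lift k i)) = x.
Proof. by apply: funext => i; rewrite /insert; case: unliftP => [j|] ->. Qed.

Lemma reaches_product (x : 'I_n -> A) k : (forall i, B (x i)) -> f x <> 0 ->
  reaches (x k) (f x).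
Proof.
move=> Bx fx0; pose xi i : B := exist _ (x (lift k i)) (mem_set (Bx (lift k i))).
exists [:: inl \o xi]; left; exists xi => //; split=> //.
exists k => //; exists 1%g => //; exists (x k) => //; congr f.
rewrite -[RHS](insert_lift x k); congr insert.
by apply: funext => i /=; rewrite perm1.
Qed.

(** Both entries reach the product: one goes up from the first to the product and
    comes back down to the second. *)
Lemma connected_entries (x : 'I_n -> A) i j : free_set B ->
  (forall k, B (x k)) -> f x <> 0 -> connected f B (x i) (x j).
Proof.
move=> freeB Bx fx0; apply/connectedE.
apply: reaches_trans (reaches_product i Bx fx0) _.
by apply: reaches_sym (reaches_product j Bx fx0); exact: (free_neq0 freeB).
Qed.

End Connection.

(** * Merging linked classes *)

Section Merging.
Local Open Scope ring_scope.
Local Open Scope classical_set_scope.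
Variables (K : fieldType) (n : nat) (A : lmodType K) (f : ('I_n -> A) -> A).
Variable B : set A.
Hypothesis basisB : is_basis B.
Local Notation cl := (class_of B (connected f B)).

Let freeB : free_set B := basisB.1.

Lemma connected_sym e e' : B e -> connected f B e e' -> connected f B e' e.
Proof.
move=> Be /connectedE ee'; apply/connectedE; apply: reaches_sym ee'.
exact: free_neq0 Be.
Qed.

Lemma connected_trans e1 e2 e3 :
  connected f B e1 e2 -> connected f B e2 e3 -> connected f B e1 e3.
Proof.
move=> /connectedE e12 /connectedE e23; apply/connectedE.
exact: reaches_trans e12 e23.
Qed.

Lemma mem_class b : B b -> cl b b.
Proof. by move=> Bb; split=> //; left. Qed.

Lemma basis_classP c b : basis_classes f B c -> c b -> B b /\ c = cl b.
Proof.
move=> [e Be <-] [Bb eb]; split=> //; apply/seteqP; split=> v [Bv ev].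
  by split=> //; apply: connected_trans ev; exact: connected_sym.
by split=> //; exact: connected_trans ev.
Qed.

Lemma basis_class_cl b : B b -> basis_classes f B (cl b).
Proof. by move=> Bb; exists b. Qed.

Lemma direct_sum_basis_classes :
  direct_sum (basis_classes f B) (@class_sub K A).
Proof.
apply: (direct_sum_span (S := id) basisB) => //.
  apply/seteqP; split=> [b [c cB /(basis_classP cB)[]]//|b Bb].
  by exists (cl b); [exact: basis_class_cl|exact: mem_class].
move=> c d b cB dB /(basis_classP cB)[_ ->] /(basis_classP dB)[_ ->].
by [].
Qed.

Lemma class_sub_inj c d : basis_classes f B c -> basis_classes f B d ->
  class_sub c = class_sub d -> c = d.
Proof.
move=> cB dB cd; have [_ _ VI] := direct_sum_basis_classes.
apply: contrapT => ncd; have [b Bb cE] := cB.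
have cb : c b by rewrite -cE; exact: mem_class.
apply: (free_neq0 freeB Bb); have : [set 0] b => //.
rewrite -(VI c cB); split; first exact: sub_span.
apply: sub_span; exists d; first by split=> // dc; exact: ncd.
by rewrite -cd; exact: sub_span.
Qed.

Lemma linked_sym c d : linked f B c d -> linked f B d c.
Proof.
apply: contra_not => <-; congr sum_sub.
by apply: funext => k; rewrite setUC.
Qed.

Lemma approx_sym V W : approx f B V W -> approx f B W V.
Proof.
move=> [->|[m [xi [xiB <- <- lk]]]]; [by left|right].
exists m, (fun r => xi (m - r)%N); split=> [r _|||r rm].
- by apply: xiB; exact: leq_subr.
- by rewrite subn0.
- by rewrite subnn.
- by rewrite -(subnSK rm); apply/linked_sym/lk;
  rewrite ltn_subrL (leq_ltn_trans _ rm).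
Qed.

(** Two consecutive chains of classes agree at the junction as subspaces, and
    [class_sub_inj] makes them agree as classes. *)
Lemma approx_trans U V W :
  approx f B U V -> approx f B V W -> approx f B U W.
Proof.
move=> [->//|[m [xi [xiB <- xiV lk]]]] [<-|[p [zi [ziB ziV <- lk']]]].
  by right; exists m, xi.
have zixi : zi 0%N = xi m.
  by apply: class_sub_inj; [exact: ziB|exact: xiB|rewrite ziV xiV].
right; exists (m + p)%N, (fun r => if (r <= m)%N then xi r else zi (r - m)%N).
split=> [r rmp|||r rmp] //=.
- by case: leqP => [|_]; [exact: xiB|apply: ziB; rewrite leq_subLR].
- case: p ziB lk' => [|p] _ _; first by rewrite addn0 leqnn zixi.
  by rewrite leqNgt -addSnnS ltnS leq_addr /= addSnnS addKn.
- have [rm|mr] := ltnP r m; first by rewrite (ltnW rm); exact: lk.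
  have -> : (if (r <= m)%N then xi r else zi (r - m)%N) = zi (r - m)%N.
    case: leqP => // rm; have -> : r = m by apply/eqP; rewrite eqn_leq rm.
    by rewrite subnn zixi.
  by rewrite subSn//; apply: lk'; rewrite ltn_subLR.
Qed.

(** The part of the basis that spans [merged_sub C]. *)
Definition basis_part (C : set (set A)) : set A :=
  [set b | B b /\ C (class_sub (cl b))].

Lemma merged_subE C : sub_classes f B C -> merged_sub C = spanS (basis_part C).
Proof.
move=> [V _ <-]; set C' := class_of _ _ _.
apply/seteqP; split; apply: span_min; try exact: span_subspace.
  move=> x [W WC]; have [[c cB cW] _] := WC.
  rewrite -cW; apply: span_mono => b cb.
  have [Bb cE] := basis_classP cB cb; split=> //.
  by rewrite -cE cW.
move=> b [Bb Cb]; apply: sub_span; exists (class_sub (cl b)) => //.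
by apply: sub_span; exact: mem_class.
Qed.

Lemma sub_class_of b : B b ->
  sub_classes f B (class_of (class_subs f B) (approx f B) (class_sub (cl b))).
Proof.
move=> Bb; exists (class_sub (cl b)) => //.
by exists (cl b) => //; exact: basis_class_cl.
Qed.

Lemma sub_class_eq C D W :
  sub_classes f B C -> sub_classes f B D -> C W -> D W -> C = D.
Proof.
move=> [V _ <-] [V' _ <-] [_ VW] [_ V'W].
apply/seteqP; split=> U [BU VU]; split=> //.
  by apply: approx_trans V'W _; apply: approx_trans VU; exact: approx_sym.
by apply: approx_trans VW _; apply: approx_trans VU; exact: approx_sym.
Qed.

Lemma direct_sum_sub_classes :
  direct_sum (sub_classes f B) (@merged_sub K A).
Proof.
apply: (direct_sum_span basisB merged_subE).
  apply/seteqP; split=> [b [C _ []]//|b Bb].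
  exists (class_of (class_subs f B) (approx f B) (class_sub (cl b))).
    exact: sub_class_of.
  split=> //; split; last by left.
  by exists (cl b) => //; exact: basis_class_cl.
by move=> C D b CB DB [_ Cb] [_ Db]; exact: sub_class_eq Cb Db.
Qed.

(** The terms outside [d] belong to the summands of the other classes. *)
Lemma Pi_sum d (s : seq A) (c : A -> K) : basis_classes f B d ->
  (forall v, v \in s -> B v) ->
  Pi f B d (\sum_(v <- s) c v *: v) = \sum_(v <- s | v \in d) c v *: v.
Proof.
move=> dB sB; apply: proj_eq => //; first exact: direct_sum_basis_classes.
  apply: subspace_sum; first exact: span_subspace.
  move=> v _ /set_mem dv; apply: subspaceZ (span_subspace _) _.
  exact: sub_span.
rewrite [X in X - _](bigID [pred v | v \in d]) /= addrC addrK.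
apply: subspace_sum; first exact: span_subspace.
move=> v vs vd; apply: subspaceZ (span_subspace _) _.
apply: sub_span; exists (cl v); last first.
  by apply: sub_span; apply: mem_class; exact: sB.
split; first by apply: basis_class_cl; exact: sB.
move=> vE; move: vd; rewrite (mem_set (A := d))// -vE.
by apply: mem_class; exact: sB.
Qed.

(** As the entries [x i] all lie in [c], the product belongs to [prod2] of the
    span of [c] at any two places; two places exist because [n >= 2]. *)
Lemma linked_of_product (c d : set A) (x : 'I_n -> A) : (2 <= n)%N ->
  (forall i, c (x i)) -> Pi f B d (f x) <> 0 -> linked f B c d.
Proof.
move=> n2 cx Px0 sum0; apply: Px0.
have : [set 0] (Pi f B d (f x)) => //; rewrite -sum0.
apply: sub_span.
exists (Ordinal (ltnW n2), Ordinal n2) => //=.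
apply: sub_span; right; exists (f x) => //.
by apply: sub_span; exists x => //; split; exact: sub_span.
Qed.

(** A basis vector [v] occurring in the product makes the component of the product
    along the class of [v] nonzero, so this class is linked to that of the
    entries. *)
Lemma product_in_merged_class C (x : 'I_n -> A) r : (2 <= n)%N ->
  sub_classes f B C -> (forall i, B (x i)) -> basis_part C (x r) ->
  merged_sub C (f x).
Proof.
move=> n2 CB Bx [_ Cr]; have sC : subspace (merged_sub C).
  exact: span_subspace.
have [fx0|fx0] := pselect (f x = 0); first by rewrite fx0; exact: subspace0 sC.
have xr i : cl (x r) (x i) by split=> //; exact: connected_entries.
have : spanS B (f x) by rewrite basisB.2.
move=> /spanP[s [c [us sB fxE]]]; rewrite fxE.
apply: (subspace_sum sC) => v vs _; have Bv := sB v vs.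
have [->|/eqP cv0] := eqVneq (c v) 0.
  by rewrite scale0r; exact: subspace0 sC.
apply: (subspaceZ _ sC); rewrite merged_subE//; apply: sub_span; split=> //.
have lk : linked f B (cl (x r)) (cl v).
  apply: linked_of_product xr _ => //; rewrite fxE Pi_sum//; last first.
    exact: basis_class_cl.
  rewrite -big_filter => sum0; apply: cv0.
  apply: (freeB _ _ sum0); first exact: filter_uniq.
    by move=> w; rewrite mem_filter => /andP[_ /sB].
  by rewrite mem_filter vs andbT; apply: mem_set; exact: mem_class.
have app : approx f B (class_sub (cl (x r))) (class_sub (cl v)).
  right; exists 1%N, (fun k => if k is 0%N then cl (x r) else cl v).
  by split=> // -[|k] //= _; exact: basis_class_cl.
move: CB Cr => [V _ <-] [_ Vr]; split; last exact: approx_trans app.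
by exists (cl v) => //; exact: basis_class_cl.
Qed.

Hypothesis f_multilinear : multilinear f.

Lemma ideal_merged_sub C : (2 <= n)%N -> sub_classes f B C ->
  ideal f (merged_sub C).
Proof.
move=> n2 CB; split=> [|r]; first exact: span_subspace.
apply: span_min; first exact: span_subspace.
move=> _ [x xr <-].
apply: (multilinear_span (S := fun i => if i == r then basis_part C else B)) => //.
- exact: span_subspace.
- move=> {xr}x Sx; have xr : basis_part C (x r) by have := Sx r; rewrite eqxx.
  apply: (product_in_merged_class n2 CB _ xr) => i.
  by have := Sx i; case: eqP => // _ [].
- move=> i; case: eqP => [->|_]; first by rewrite -merged_subE.
  by rewrite basisB.2.
Qed.

(** A nonzero product of basis vectors would have connected entries in the parts
    of [C] and of [D], so that [C] and [D] would share a summand. *)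
Lemma orthogonal_merged_sub C D : sub_classes f B C -> sub_classes f B D ->
  C <> D -> f_orthogonal f (merged_sub C) (merged_sub D).
Proof.
move=> CB DB CD k1 k2 k12; apply: eq0_set1; first exact: span_subspace.
apply: span_min; first exact: set1_0_subspace.
move=> _ [x [xk1 xk2] <-].
pose S i := if i == k1 then basis_part C else if i == k2 then basis_part D else B.
apply: (multilinear_span (S := S)) => //.
- exact: set1_0_subspace.
- move=> {xk1 xk2}x Sx; apply: contrapT => fx0; apply: CD.
  have Bx i : B (x i).
    by have := Sx i; rewrite /S; case: eqP => _; [case|case: eqP => _ // []].
  have := Sx k1; rewrite /S eqxx => -[_ C1].
  have := Sx k2; rewrite /S eqxx eq_sym; case: eqP => // _ [_ D2].
  apply: (sub_class_eq CB DB C1).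
  have xk2 : cl (x k1) (x k2) by split=> //; exact: connected_entries.
  by have [_ ->] := basis_classP (basis_class_cl (Bx k1)) xk2.
- move=> i; rewrite /S; case: eqP => [->|_]; first by rewrite -merged_subE.
  case: eqP => [->|_]; first by rewrite -merged_subE.
  by rewrite basisB.2.
Qed.

End Merging.

Theorem theorem5p1 (K : fieldType) (n : nat) (hn : (2 <= n)%N)
    (A : lmodType K) (f : ('I_n -> A) -> A) (hf : multilinear f)
    (B : set A) (hB : is_basis B) :
  [/\ direct_sum (sub_classes f B) (@merged_sub K A),
      (forall C : set (set A), sub_classes f B C -> ideal f (merged_sub C))
    & forall C D : set (set A), sub_classes f B C -> sub_classes f B D ->
        merged_sub C <> merged_sub D ->
        f_orthogonal f (merged_sub C) (merged_sub D)].
Proof.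
split.
- exact: direct_sum_sub_classes.
- by move=> C; exact: ideal_merged_sub.
- move=> C D CB DB CD; apply: (orthogonal_merged_sub hB hf CB DB) => CD'.
  by apply: CD; rewrite CD'.
Qed.
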